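(* Let $n \geq 2$ and consider the absent-minded passengers process with one absent-minded passenger: there are $n$ seats labelled $1,\dots,n$ and $n$ passengers labelled $1,\dots,n$, where the correct seat of passenger $i$ is seat $i$. Passengers board in the order $1,2,\dots,n$. Passenger $1$ chooses a seat uniformly at random among all $n$ seats. Each subsequent passenger $i \geq 2$ takes seat $i$ if it is still empty, and otherwise chooses a seat uniformly at random among the currently empty seats. Define the weight-enumerator $$F_n(w_1,\dots,w_n)=\sum_{\sigma} \Pr(\sigma)\prod_{i:\ \text{passenger } i \text{ is not in seat } i \text{ in } \sigma} w_i,$$ where the sum is over all final seating arrangements $\sigma$ and $\Pr(\sigma)$ is the probability that the process ends in $\sigma$. Then $$F_n(w_1,\dots,w_n)=\frac{1-w_1}{n}+\frac{w_1}{n!}\prod_{i=2}^{n}(w_i+n+1-i).$$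
   Context: $w_1,\dots,w_n$ are commuting indeterminates; $F_n$ is a multilinear polynomial in them whose coefficient of $w_{i_1}\cdots w_{i_l}$ is the probability that exactly the passengers $i_1,\dots,i_l$ end up in a seat other than their own. *)

(* Defs.v *)
From mathcomp Require Import all_boot all_order all_fingroup all_algebra.
From mathcomp Require Import mpoly.

Set Implicit Arguments.
Unset Strict Implicit.
Unset Printing Implicit Defensive.

Import GRing.Theory.

Local Open Scope ring_scope.

(* Passengers and seats are both indexed by 'I_n, so the
   ordinal i stands for the passenger (or seat) labelled i + 1. A final seating
   arrangement is a permutation s : 'S_n, where s i is the seat of passenger i. *)

Definition empty_seats (n : nat) (s : 'S_n) (i : 'I_n) : {set 'I_n} :=
  [set x | [forall j : 'I_n, (j < i)%N ==> (s j != x)]].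

(* Conditional probability that passenger i takes seat x when E is the set of
   seats still empty. *)
Definition choice_prob (n : nat) (i : 'I_n) (E : {set 'I_n}) (x : 'I_n) : rat :=
  if (0 < i)%N && (i \in E) then (x == i)%:R
  else if x \in E then #|E|%:R^-1 else 0.

(* By the chain rule, the probability of the outcome s is the product over the
   passengers, in boarding order, of the conditional probability that each
   makes the choice prescribed by s given the choices of those before. *)
Definition seating_prob (n : nat) (s : 'S_n) : rat :=
  \prod_(i < n) choice_prob i (empty_seats s i) (s i).

Definition weight_enumerator (n : nat) : {mpoly rat[n]} :=
  \sum_(s : 'S_n) seating_prob s *: \prod_(i < n | s i != i) 'X_i.

(* Main.v *)
Require Import Defs.
From mathcomp Require Import all_boot all_order all_fingroup all_algebra.
From mathcomp Require Import mpoly.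

Import GRing.Theory.

Local Open Scope ring_scope.

(** An arrangement [s] has positive probability iff every displaced passenger
    [i] other than the first finds seat [i] taken, i.e. [s^-1 i < i]; its
    probability is then [1/n] times the product of the [1/(n-i)] over these
    passengers (0-based labels). Such an [s] is a cycle
    [0 -> a_1 -> ... -> a_k -> 0] with [a_1 < ... < a_k], i.e. a product of the
    transpositions [(0 a_1), ..., (0 a_k)] for an arbitrary set of positive
    [a_j]; hence the sum of the weights over all these [s] factors. *)

Definition attainable {n : nat} (s : 'S_n) : bool :=
  [forall i : 'I_n, (0 < i)%N && (s i != i) ==> ((s^-1)%g i < i)%N].

Lemma card_ord_lt (n : nat) (i : 'I_n) : #|[set j : 'I_n | (j < i)%N]| = i.
Proof.
rewrite -sum1dep_card -(big_ord_widen_cond n xpredT (fun=> 1%N)) ?(ltnW (ltn_ord i)) //.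
by rewrite sum1_card card_ord.
Qed.

Lemma empty_seatsE (n : nat) (s : 'S_n) (i x : 'I_n) :
  (x \in empty_seats s i) = (i <= (s^-1)%g x)%N.
Proof.
rewrite inE leqNgt; apply/forallP/idP => [/(_ ((s^-1)%g x)) | h j].
  by rewrite permKV eqxx implybF.
by apply/implyP => ji; apply: contraNneq h => <-; rewrite permK.
Qed.

Lemma card_empty_seats (n : nat) (s : 'S_n) (i : 'I_n) :
  #|empty_seats s i| = (n - i)%N.
Proof.
have -> : empty_seats s i = s @: ~: [set j : 'I_n | (j < i)%N].
  apply/setP => x; rewrite empty_seatsE -{2}(permKV s x).
  by rewrite (mem_imset _ _ (@perm_inj _ s)) !inE -leqNgt.
rewrite card_imset; last exact: perm_inj.
by rewrite cardsCs setCK card_ord card_ord_lt.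
Qed.

(** Seat [s i] is always still empty when [i] boards, and seat [i] is taken exactly when
    [(s^-1)%g i < i]. A displaced passenger [i > 0] whose seat is still empty gives 0, since that
    choice was forced. *)
Lemma choice_probE (n : nat) (s : 'S_n) (i : 'I_n) :
  choice_prob i (empty_seats s i) (s i) =
  if (0 < i)%N
  then if s i == i then 1
       else if ((s^-1)%g i < i)%N then (n - i)%:R^-1 else 0
  else n%:R^-1.
Proof.
rewrite /choice_prob !empty_seatsE permK leqnn card_empty_seats.
case: posnP => [-> | i0] /=; first by rewrite subn0.
case: eqP => [si | _]; last by case: ltnP.
by have := permK s i; rewrite si => ->; rewrite leqnn.
Qed.

Lemma seating_probE (n : nat) (s : 'S_n.+1) :
  seating_prob s =
  if attainable s
  then n.+1%:R^-1 *
       \prod_(i < n.+1 | (0 < i)%N && (s i != i)) (n.+1 - i)%:R^-1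
  else 0.
Proof.
rewrite /seating_prob; case: ifPn => [/forallP ok | /forallPn [i]].
  rewrite (bigD1 ord0) //= choice_probE; congr (_ * _).
  rewrite [RHS]big_mkcondr; apply: eq_big => [i | i]; rewrite -lt0n //.
  move=> i0; rewrite choice_probE i0.
  by have := ok i; rewrite i0 /=; case: eqP => //= _ ->.
rewrite negb_imply => /andP [/andP [i0 si] lti].
by rewrite (bigD1 i) //= choice_probE i0 (negbTE si) (negbTE lti) mul0r.
Qed.

(** The smallest displaced passenger must be 0: were it positive, its seat would have been taken by
    a smaller passenger, also displaced. *)
Lemma attainable_fix0 (n : nat) (s : 'S_n.+1) :
  attainable s -> (s ord0 == ord0) = (s == 1%g).
Proof.
move=> /forallP ok; apply/eqP/eqP => [s0 | ->]; last by rewrite perm1.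
suff fixs m (i : 'I_n.+1) : (i < m)%N -> s i = i.
  by apply/permP => i; rewrite perm1; apply: (fixs n.+1).
elim: m i => // m IHm i; rewrite ltnS => im.
have [/eqP i0 | i0] := posnP i.
  by have -> : i = ord0 by apply/val_inj/eqP.
apply/eqP; have := ok i; rewrite i0 /=; apply: contraLR => si.
rewrite negb_imply si; apply: contra si => lti.
have := IHm _ (leq_trans lti im); rewrite permKV => {1}->.
by rewrite permKV.
Qed.

(** This filters arrangements by their largest displaced passenger, the parameter of the induction
    computing the sum. *)
Definition fixed_from {n : nat} (m : nat) (s : 'S_n) : bool :=
  [forall i : 'I_n, (m <= i)%N ==> (s i == i)].

Section Transposition.

Variables (n : nat) (m : 'I_n.+1).
Hypothesis m_gt0 : (0 < m)%N.

Let t := tperm ord0 m.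

(** Seats above [m] are held by their owners. If [0 < s m < m], passenger [s m] would be displaced
    although its seat is taken only later, by [m]. *)
Lemma attainable_top (s : 'S_n.+1) :
  attainable s -> fixed_from m.+1 s -> s m != m -> s m = ord0.
Proof.
move=> /forallP ok /forallP fx sm; apply/eqP; apply: contraNT sm => sm0.
have [/(implyP (fx _)) | le_sm] := ltnP m (s m).
  by rewrite (inj_eq perm_inj).
apply: contraLR (ok (s m)) => sm; rewrite negb_imply permK -leqNgt le_sm.
by rewrite (inj_eq perm_inj) sm lt0n (_ : _ != 0%N).
Qed.

Lemma mul_tperm_fixed (s : 'S_n.+1) (i : 'I_n.+1) :
  i != ord0 -> i != m -> ((s * t)%g i == i) = (s i == i).
Proof.
move=> i0 im; have ti : t i = i by rewrite tpermD // eq_sym.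
by rewrite permM -[X in _ == X]ti (inj_eq perm_inj).
Qed.

(** Multiplying by [t] swaps seats 0 and [m]: passenger [m] moves to seat 0, and the former occupant
    of seat 0 moves to seat [m]. This appends [m] at the end of the cycle through 0. *)
Lemma attainable_mul_tperm (s : 'S_n.+1) :
  [&& attainable (s * t)%g, fixed_from m.+1 (s * t)%g & (s * t)%g m != m]
  = attainable s && fixed_from m s.
Proof.
have m0 : m != ord0 by rewrite -val_eqE -lt0n.
have pre (i : 'I_n.+1) : i != ord0 -> i != m -> ((s * t)^-1)%g i = (s^-1)%g i.
  by move=> i0 im; rewrite invMg permM tpermV tpermD // eq_sym.
apply/and3P/andP => [[ok fx stm] | [/forallP ok /forallP fx]].
  have sm : s m = m.
    by apply: (@perm_inj _ t); rewrite -permM attainable_top // tpermR.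
  move/forallP: ok => ok; move/forallP: fx => fx.
  split; apply/forallP => i; apply/implyP.
    case/andP => i0 si; have im : i != m by apply: contraNneq si => ->; rewrite sm.
    have i0' : i != ord0 by rewrite -val_eqE -lt0n.
    by have := ok i; rewrite i0 mul_tperm_fixed // si pre.
  rewrite leq_eqVlt => /orP [/eqP/val_inj <- | mi]; first by rewrite sm.
  have im : i != m by rewrite -val_eqE gtn_eqF.
  have i0 : i != ord0 by rewrite -val_eqE -lt0n (leq_trans _ mi).
  by have := fx i; rewrite mi mul_tperm_fixed.
have sm : s m = m by apply/eqP/(implyP (fx m)).
have stm : (s * t)%g m = ord0 by rewrite permM sm tpermR.
split; last by rewrite stm eq_sym.
  apply/forallP => i; apply/implyP => /andP [i0 si].
  have i0' : i != ord0 by rewrite -val_eqE -lt0n.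
  have [-> | im] := eqVneq i m; last first.
    rewrite pre //; apply: (implyP (ok i)).
    by rewrite i0 -mul_tperm_fixed.
  (* The new occupant of seat [m] is [(s^-1)%g ord0]. It lies below [m], since [s] fixes everything
     from [m] on and [m > 0]. *)
  rewrite invMg permM tpermV tpermR ltnNge; apply/negP => le_m.
  have := implyP (fx _) le_m; rewrite permKV => /eqP e.
  by move: le_m; rewrite -e leqNgt m_gt0.
apply/forallP => i; apply/implyP => mi.
have im : i != m by rewrite -val_eqE gtn_eqF.
have i0 : i != ord0 by rewrite -val_eqE -lt0n (leq_trans _ mi).
by rewrite mul_tperm_fixed // (implyP (fx i)) // ltnW.
Qed.

(** Among positive passengers only [m] changes status. Index 0 is left out because it also becomes
    displaced when [s] fixes it. *)
Lemma prod_displaced_mul_tperm (R : comNzRingType) (g : 'I_n.+1 -> R)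
    (s : 'S_n.+1) :
  s m = m ->
  \prod_(i < n.+1 | (0 < i)%N && ((s * t)%g i != i)) g i =
  g m * \prod_(i < n.+1 | (0 < i)%N && (s i != i)) g i.
Proof.
move=> sm; have m0 : ord0 != m by rewrite -val_eqE /= eq_sym -lt0n.
rewrite (bigD1 m) /=; last by rewrite m_gt0 permM sm tpermR.
congr (_ * _); apply: eq_bigl => i.
have [-> | im] := eqVneq i m; first by rewrite sm eqxx !andbF.
rewrite andbT; case: posnP => //= i0.
by rewrite mul_tperm_fixed // -val_eqE -lt0n.
Qed.

End Transposition.

(** By induction on [m]: the arrangements fixing the new top passenger [k] contribute the previous
    sum, and those displacing it contribute [g k] times that sum, whence the factor [1 + g k]. *)
Lemma sum_attainable_fixed_from (R : comNzRingType) (n m : nat)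
    (g : 'I_n.+1 -> R) : (m <= n)%N ->
  \sum_(s : 'S_n.+1 | attainable s && fixed_from m.+1 s)
     \prod_(i < n.+1 | (0 < i)%N && (s i != i)) g i =
  \prod_(i < n.+1 | (0 < i <= m)%N) (1 + g i).
Proof.
elim: m => [_ | m IHm lt_mn].
  rewrite [RHS]big_pred0 => [|i]; last by case: (val i).
  rewrite (big_pred1 1%g) => [|s].
    by rewrite big_pred0 // => i; rewrite perm1 eqxx andbF.
  apply/andP/eqP => [[ok /forallP fx] | ->]; last first.
    by split; apply/forallP => i; apply/implyP; rewrite perm1 eqxx ?andbF.
  (* If [s ord0] were positive it would be a fixed point, contradicting injectivity. *)
  apply/eqP; rewrite -attainable_fix0 //; apply/contraT => s0.
  have := fx (s ord0); rewrite lt0n -[_ != _]/(s ord0 != ord0) s0 /=.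
  by rewrite (inj_eq perm_inj) (negbTE s0).
pose k : 'I_n.+1 := Ordinal (lt_mn : (m.+1 < n.+1)%N).
rewrite (bigID (fun s : 'S_n.+1 => s k == k)) /=.
rewrite [RHS](bigD1 k) /=; last by rewrite leqnn.
rewrite mulrDl mul1r.
have -> : \prod_(i < n.+1 | (0 < i <= m.+1)%N && (i != k)) (1 + g i) =
          \prod_(i < n.+1 | (0 < i <= m)%N) (1 + g i).
  by apply: eq_bigl => i; rewrite -val_eqE /= -andbA [X in _ && X]andbC -ltn_neqAle.
rewrite -IHm; last exact: ltnW.
congr (_ + _).
  apply: eq_bigl => s; rewrite -andbA; congr (_ && _).
  apply/andP/forallP => [[/forallP fx sk] i | fx]; last first.
    split; last exact: (implyP (fx k)).
    by apply/forallP => i; apply/implyP => mi; apply: (implyP (fx i)); apply: ltnW.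
  apply/implyP; rewrite leq_eqVlt => /orP [/eqP e | ]; last exact: (implyP (fx i)).
  by have <- : k = i by exact: val_inj.
rewrite (reindex_inj (mulIg (tperm ord0 k))) /= mulr_sumr.
apply: eq_big => [s | s].
  by rewrite -andbA (attainable_mul_tperm n k).
rewrite -andbA (attainable_mul_tperm n k) // => /andP [_ /forallP fx].
by apply: prod_displaced_mul_tperm => //; apply/eqP/(implyP (fx k)).
Qed.

Lemma sum_attainable (R : comNzRingType) (n : nat) (g : 'I_n.+1 -> R) :
  \sum_(s : 'S_n.+1 | attainable s)
     \prod_(i < n.+1 | (0 < i)%N && (s i != i)) g i =
  \prod_(i < n.+1 | (0 < i)%N) (1 + g i).
Proof.
have := sum_attainable_fixed_from R n n g (leqnn n).
rewrite (eq_bigl (@attainable n.+1)) => [-> | s].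
  by apply: eq_bigl => i; rewrite leq_ord andbT.
rewrite andb_idr // => _; apply/forallP => i.
by rewrite leqNgt ltn_ord.
Qed.

Lemma prod_succ_sub_fact (n : nat) :
  (\prod_(i < n.+1 | (0 < i)%N) (n.+1 - i) = n`!)%N.
Proof.
rewrite fact_prod big_add1 big_mkord (reindex_inj rev_ord_inj) /=.
(* After the reversal the excluded index 0 comes last, where it contributes 1. *)
rewrite big_mkcond big_ord_recr /= subnn muln1.
apply: eq_bigr => i _; rewrite subKn ?subSS ?subn_gt0 ?ltn_ord //.
by rewrite ltnS ltnW.
Qed.

Theorem theorem1 (n : nat) (hn : (2 <= n)%N) :
  let w1 : {mpoly rat[n]} := 'X_(Ordinal (ltnW hn)) in
  weight_enumerator n =
    n%:R^-1 *: (1 - w1)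
    + (n`!)%:R^-1 *: (w1 * \prod_(i < n | (0 < i)%N)
                             ('X_i + n%:R + 1 - (i.+1)%:R)).
Proof.
case: n hn => // n hn w1.
have w1E : w1 = 'X_ord0 by congr ('X_ _); apply: val_inj.
pose c (i : 'I_n.+1) : rat := (n.+1 - i)%:R.
(* [g i] merges the weight of a displaced passenger with the probability [1/(n.+1 - i)] of its
   choice. *)
pose g (i : 'I_n.+1) : {mpoly rat[n.+1]} := (c i)^-1 *: 'X_i.
pose P (s : 'S_n.+1) := \prod_(i < n.+1 | (0 < i)%N && (s i != i)) g i.
have termE s : attainable s ->
    seating_prob s *: \prod_(i < n.+1 | s i != i) 'X_i =
    n.+1%:R^-1 *: ((if s == 1%g then 1 else w1) * P s) :> {mpoly rat[n.+1]}.
  move=> ok; rewrite seating_probE ok -scalerA; congr (_ *: _).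
  rewrite /P /g scaler_prod -attainable_fix0 // w1E.
  rewrite -scalerAr; congr (_ *: _).
  rewrite big_mkcond (bigD1 ord0) //= if_neg; congr (_ * _).
  by rewrite [RHS]big_mkcondr; apply: eq_bigl => i; rewrite -lt0n.
have ok1 : attainable (1%g : 'S_n.+1).
  by apply/forallP => i; rewrite perm1 eqxx andbF.
have P1 : P 1%g = 1 by rewrite /P big_pred0 // => i; rewrite perm1 eqxx andbF.
(* Passenger 0 contributes [w1] for every attainable arrangement but the identity; giving the
   identity [w1] as well is corrected by [1 - w1]. *)
have -> : weight_enumerator n.+1 =
    n.+1%:R^-1 *: (1 - w1) + n.+1%:R^-1 *: (w1 * \sum_(s | attainable s) P s).
  rewrite -scalerDr /weight_enumerator (bigID (@attainable n.+1)) /=.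
  rewrite [X in _ + X]big1 ?addr0 => [|s /negbTE nok]; last first.
    by rewrite seating_probE nok scale0r.
  rewrite (eq_bigr _ termE) -scaler_sumr; congr (_ *: _).
  rewrite !(bigD1 1%g ok1) /= eqxx P1 mulrDr !mulr1 addrA subrK; congr (_ + _).
  by rewrite mulr_sumr; apply: eq_bigr => s /andP [_ /negbTE ->].
congr (_ + _); rewrite sum_attainable factS natrM invfM -scalerA; congr (_ *: _).
rewrite scalerAr; congr (_ * _).
rewrite -prod_succ_sub_fact natr_prod -prodfV -scaler_prod.
apply: eq_bigr => i _.
have c0 : c i != 0 by rewrite Num.Theory.pnatr_eq0 -lt0n subn_gt0.
(* Here [1 + 'X_i / c i = ('X_i + c i) / c i], and [c i] equals [n.+1 + 1 - i.+1], with [i.+1] the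
   1-based label. *)
rewrite /g addrC -[X in _ + X](scalerK c0) -scalerDr; congr (_ *: _).
rewrite scaler_nat natrB ?(ltnW (ltn_ord i)) // -[i.+1%:R]natr1 opprD.
by rewrite -!addrA; congr (_ + (_ + _)); rewrite addrCA subrr addr0.
Qed.
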